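(* Let $X$ be any real random variable, and let $s_1,s_2$ be real numbers with $s_1\le 0\le s_2$ such that $\mathsf{E}\, e^{sX}<\infty$ for all $s\in[s_1,s_2]$. Let $p>0$ and $\ell:=\lceil p-1\rceil$. Then for any $s\in(0,s_2]$ and any $j\in\{-1,0,1,\dots,\ell\}$ such that $\mathsf{E}|X|^{j_+}<\infty$ (with $j_+=\max(j,0)$ and the convention $0^0:=1$), one has \[ \mathsf{E}\, X_+^p=\frac{\Gamma(p+1)}{2\pi}\int_{-\infty}^{\infty}\frac{\mathsf{E}\, e_j\big((s+it)X\big)}{(s+it)^{p+1}}\,dt =\frac{\Gamma(p+1)}{\pi}\int_{0}^{\infty}\operatorname{Re}\frac{\mathsf{E}\, e_j\big((s+it)X\big)}{(s+it)^{p+1}}\,dt, \] where both integrals exist in the Lebesgue sense.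
   Context: $x_+:=\max(0,x)$ and $x_+^p:=(x_+)^p$. For complex $z$ and $m\in\{-1,0,1,\dots\}$, $e_m(z):=e^z-\sum_{j=0}^m z^j/j!$ (an empty sum is $0$, so $e_{-1}(z)=e^z$). For $z$ with $\operatorname{Re} z>0$, $z^{p+1}$ denotes the principal branch $\exp((p+1)\operatorname{Log} z)$. The statement ''the identity holds'' includes the assertion that the integrals exist in the Lebesgue sense (possibly infinite). *)

(* Defs.v *)
From HB Require Import structures.
From mathcomp Require Import all_boot all_order all_algebra.
From mathcomp Require Import all_classical all_reals all_analysis.
From mathcomp.real_closed Require Import complex.
Set Implicit Arguments. Unset Strict Implicit. Unset Printing Implicit Defensive.
Import Order.TTheory GRing.Theory Num.Theory.
Local Open Scope ring_scope.
Local Open Scope complex_scope.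

Section Defs.
Variable R : realType.

Definition cexp (z : R[i]) : R[i] :=
  (expR (complex.Re z) * cos (complex.Im z)) +i* (expR (complex.Re z) * sin (complex.Im z)).

(* e_m(z) = e^z - sum_{k=0}^m z^k/k!, m in {-1,0,1,...}; empty sum for m = -1 *)
Definition e_ (m : int) (z : R[i]) : R[i] :=
  cexp z - \sum_(0 <= k < absz (m + 1)) z ^+ k / (k`!)%:R.

Definition cmod (z : R[i]) : R := Num.sqrt (complex.Re z ^+ 2 + complex.Im z ^+ 2).

(* principal logarithm, valid for complex.Re z > 0 (where Arg z = atan (complex.Im z / complex.Re z)) *)
Definition cLog_rpos (z : R[i]) : R[i] := ln (cmod z) +i* atan (complex.Im z / complex.Re z).

Definition cpow_rpos (z : R[i]) (a : R) : R[i] := cexp (a%:C * cLog_rpos z).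

Definition Gamma (a : R) : R :=
  fine (\int[@lebesgue_measure R]_(x in `]0%R, +oo[%classic)
          (powR x (a - 1) * expR (- x))%:E)%E.

End Defs.

(* Main.v *)
Require Import Defs.
From HB Require Import structures.
From mathcomp Require Import all_boot all_order all_algebra.
From mathcomp Require Import all_classical all_reals all_analysis.
From mathcomp Require Import measurable_realfun lebesgue_integral_under.
From mathcomp Require Import zify ring lra.
From mathcomp.real_closed Require Import complex.
Import Order.TTheory GRing.Theory Num.Theory.
Local Open Scope ring_scope.
Local Open Scope complex_scope.

(** Write z = s + it and a = p + 1. The gamma kernel u_+^p e^(-su) has Fourier
    transform G(t) = Gamma(a) z^(-a): integration by parts shows that z^a G(t) has
    zero derivative in t, and its value at t = 0 is Gamma(a). Fourier inversion,
    obtained by inserting e^(-c|t|), whose transform is the Cauchy kernel, and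
    letting c -> 0, then gives for every real x
      Gamma(a) int e^(zx) z^(-a) dt = 2 pi x_+^p.
    At x = 0 this says that int z^(-b) dt = 0 for every b > 1, so the Taylor terms
    subtracted from the exponential in e_j do not contribute, their exponents
    a - k being larger than 1 because k <= j < p. The theorem follows by Fubini,
    since |e^(zX) z^(-a)| = e^(sX) |z|^(-a) is integrable for dt x P. *)

(** As s > 0 is fixed, z = s + it stays away from 0, so no estimate of e_j near the origin enters:
    the exponential and every Taylor term are integrable in t on their own. The obstacle in the
    inversion is that u_+^p e^(-su) e^(it(x-u)) has a modulus independent of t, so its double
    integral does not converge absolutely and Fubini does not apply. The factor e^(-c|t|) repairs
    this, and removing it afterwards costs nothing: |G(t)| = Gamma(a) |z|^(-a) is itself integrable
    because a > 1, so no principal value arises. On the other side of the identity the limit c -> 0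
    needs the gamma kernel to be bounded and continuous on the whole line; at 0 this is where p > 0
    enters. Complex integrals are carried as real ones, a modulus times a cosine with a phase.
    Shifting the phase by -pi/2 turns a real part into an imaginary part, so most lemmas serve for
    both. *)

Section Laplace_inversion.
Import numFieldNormedType.Exports.
Local Open Scope classical_set_scope.
Local Open Scope ring_scope.
Set Implicit Arguments.
Unset Strict Implicit.

(** * Change of variables and improper integrals *)

Section Lebesgue_tools.
Context {R : realType}.
Notation mu := (@lebesgue_measure R).
Notation measR := (measurableTypeR R).

(** Uniqueness of Lebesgue measure: the scaled pushforward is a measure that agrees with it on
    half-open intervals. *)
Lemma lebesgue_measure_affine (c b : R) : 0 < c -> forall A : set R,
  measurable A -> mu A = (c%:E * mu ((fun x => c * x + b)%R @^-1` A))%E.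
Proof.
move=> c0 A mA.
have mphi : measurable_fun setT ((fun x => c * x + b) : measR -> measR).
  by apply: measurable_funD => //; apply: measurable_funM.
rewrite -[c]/((PosNum c0)%:num).
pose pf := measure_function_pushforward__canonical__measure_function_Measure mu mphi.
transitivity (mscale (PosNum c0)%:num%:nng pf A); last by [].
apply: lebesgue_measure_unique => //= _ [[u v]] _ <-.
rewrite /= /mscale /= /pushforward /=.
have -> : (fun x : R => c * x + b) @^-1` `]u, v] = `](u - b) / c, (v - b) / c]%classic.
  by apply/seteqP; split => x /=; rewrite !in_itv/= ltr_pdivrMr// ler_pdivlMr//; lra.
rewrite !lebesgue_measure_itv /= !lte_fin ltr_pM2r ?invr_gt0// ltrD2r.
case: ifP => _; last by rewrite mule0.
by rewrite -!EFinB -EFinM; congr EFin; field; rewrite gt_eqF.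
Qed.

Section change_of_variables.
Variables (phi : measR -> measR) (k : R).
Hypotheses (mphi : measurable_fun setT phi) (k0 : 0 < k).
Hypothesis scaling : forall A : set R, measurable A ->
  mu A = (k%:E * mu (phi @^-1` A))%E.

Let ge0_integral_comp (f : R -> \bar R) : measurable_fun setT f ->
  (forall x, 0 <= f x)%E ->
  (\int[mu]_x f x = k%:E * \int[mu]_x f (phi x))%E.
Proof.
move=> mf f0.
pose pf := measure_function_pushforward__canonical__measure_function_Measure mu mphi.
pose k' : {nonneg R} := NngNum (ltW k0).
transitivity (\int[mscale k' pf]_x f x)%E.
  by apply: eq_measure_integral => A mA _; exact: scaling.
rewrite ge0_integral_mscale//; congr (_ * _)%E.
by rewrite ge0_integral_pushforward.
Qed.

Lemma integrable_comp_scaling (f : R -> R) :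
  mu.-integrable setT (EFin \o f) -> mu.-integrable setT (EFin \o (f \o phi)).
Proof.
move=> /integrableP[mf foo]; apply/integrableP; split.
  exact: (measurableT_comp mf).
have := foo; rewrite ge0_integral_comp //; last exact: measurableT_comp.
apply: contraTT; rewrite -!leNgt !leye_eq => /eqP /= ->.
by rewrite gt0_muley ?lte_fin.
Qed.

(** The nonnegative case is applied to the positive and negative parts; [k] factors out of their
    difference because both have a finite integral. *)
Lemma Rintegral_comp_scaling (f : R -> R) :
  mu.-integrable setT (EFin \o f) ->
  \int[mu]_x f x = k * \int[mu]_x f (phi x).
Proof.
move=> intf.
have mf : measurable_fun setT (EFin \o f) by exact: measurable_int intf.
have intfphi := integrable_comp_scaling intf.
have posfin : (\int[mu]_x (EFin \o f)^\+%E (phi x))%E \is a fin_num.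
  have := integrable_pos_fin_num measurableT intfphi.
  by under eq_integral do rewrite -[_ \o _]/((EFin \o f) \o phi) funepos_comp.
have negfin : (\int[mu]_x (EFin \o f)^\-%E (phi x))%E \is a fin_num.
  have := integrable_neg_fin_num measurableT intfphi.
  by under eq_integral do rewrite -[_ \o _]/((EFin \o f) \o phi) funeneg_comp.
transitivity (k * fine (\int[mu]_x (EFin \o f)^\+%E (phi x) -
                       \int[mu]_x (EFin \o f)^\-%E (phi x))%E).
  rewrite /Rintegral integralE (ge0_integral_comp (measurable_funepos mf))//.
  rewrite (ge0_integral_comp (measurable_funeneg mf))//.
  rewrite -muleBr ?fin_num_adde_defr//.
  by rewrite fineM// fin_numB; apply/andP.
congr (_ * fine _); rewrite [RHS]integralE.
congr (_ - _)%E; apply: eq_integral => x _.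
  exact: (esym (congr1 (@^~ x) (funepos_comp (EFin \o f) phi))).
exact: (esym (congr1 (@^~ x) (funeneg_comp (EFin \o f) phi))).
Qed.

End change_of_variables.

(** The factor [1%:E] gives the reflection the shape of [scaling], so that the change of variables
    applies with [k = 1]. *)
Lemma lebesgue_measure_opp (A : set R) : measurable A ->
  mu A = (1%:E * mu (-%R @^-1` A))%E.
Proof. by move=> mA; rewrite mul1e -[LHS]lebesgue_measureN. Qed.

Lemma Rintegral_affine (f : R -> R) (c b : R) : 0 < c ->
  mu.-integrable setT (EFin \o f) ->
  \int[mu]_x f x = c * \int[mu]_x f (c * x + b).
Proof.
move=> c0.
apply: (@Rintegral_comp_scaling (fun x => c * x + b) _ _ c0 (lebesgue_measure_affine b c0)).
by apply: measurable_funD => //; apply: measurable_funM.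
Qed.

Lemma integrable_affine (f : R -> R) (c b : R) : 0 < c ->
  mu.-integrable setT (EFin \o f) ->
  mu.-integrable setT (EFin \o (fun x => f (c * x + b))).
Proof.
move=> c0.
apply: (@integrable_comp_scaling (fun x => c * x + b) _ _ c0 (lebesgue_measure_affine b c0)).
by apply: measurable_funD => //; apply: measurable_funM.
Qed.

Lemma Rintegral_opp (f : R -> R) : mu.-integrable setT (EFin \o f) ->
  \int[mu]_x f x = \int[mu]_x f (- x).
Proof.
move=> intf.
by rewrite (@Rintegral_comp_scaling -%R 1 _ _ lebesgue_measure_opp)// mul1r.
Qed.

Lemma Rintegral_odd (f : R -> R) : mu.-integrable setT (EFin \o f) ->
  (forall x, f (- x) = - f x) -> \int[mu]_x f x = 0.
Proof.
move=> intf oddf; have := Rintegral_opp intf.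
under [in X in _ = X]eq_Rintegral do rewrite oddf -mulN1r.
by rewrite RintegralZl//; lra.
Qed.

(** The two open half-lines miss only the null point 0, and the reflection exchanges them. *)
Lemma Rintegral_even (f : R -> R) : mu.-integrable setT (EFin \o f) ->
  (forall x, f (- x) = f x) ->
  \int[mu]_x f x = 2 * \int[mu]_(x in `]0, +oo[) f x.
Proof.
move=> intf evenf.
pose fp := f \_ `]0, +oo[; pose fn := f \_ `]-oo, 0[.
have intS (D : set R) : measurable D -> mu.-integrable setT (EFin \o (f \_ D)).
  move=> mD; rewrite -restrict_EFin; apply/integrable_restrict => //.
  by rewrite setTI; apply: integrableS intf.
have -> : \int[mu]_x f x = \int[mu]_x (fp x + fn x).
  rewrite /Rintegral; congr fine; apply: ae_eq_integral => //.
  - by have := measurable_int _ intf.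
  - apply: (measurable_int mu); apply: (integrableD _ (intS _ _) (intS _ _)) => //.
  - exists [set 0]; split => //; first exact: lebesgue_measure_set1.
    move=> x /= /not_implyP[_ neq]; apply: contrapT => x0; apply: neq.
    rewrite /fp /fn !patchE !mem_setE !in_itv/= andbT.
    by case: (ltgtP x 0) x0 => [||->]//; rewrite ?addr0 ?add0r.
rewrite RintegralD//; [|exact: intS|exact: intS].
have -> : \int[mu]_x fn x = \int[mu]_x fp x.
  rewrite (Rintegral_opp (intS _ _))//; apply: eq_Rintegral => x _.
  by rewrite /fp /fn !patchE !mem_setE !in_itv/= andbT oppr_lt0 evenf.
by rewrite -Rintegral_mkcond mulr2n mulrDl !mul1r.
Qed.

End Lebesgue_tools.

Section Rintegral_limits.
Context {R : realType}.
Notation mu := (@lebesgue_measure R).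

Lemma dominated_Rintegral d (T : measurableType d) (nu : {measure set T -> \bar R})
    (f_ : nat -> T -> R) (f g : T -> R) :
  (forall n, measurable_fun setT (f_ n)) -> measurable_fun setT f ->
  (forall x, f_ n x @[n --> \oo] --> f x) ->
  nu.-integrable setT (EFin \o g) -> (forall n x, `|f_ n x| <= g x) ->
  \int[nu]_x f_ n x @[n --> \oo] --> \int[nu]_x f x.
Proof.
move=> mf_ mf f_f ig f_g.
have [] := @dominated_convergence _ _ _ nu setT measurableT
  (fun n => EFin \o f_ n) (EFin \o f) (EFin \o g).
- by move=> n; exact/measurable_EFinP.
- exact/measurable_EFinP.
- by apply: aeW => x _; apply/cvg_EFin; [exact: nearW|exact: f_f].
- exact: ig.
- by apply: aeW => x n _ /=; rewrite lee_fin.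
move=> intf _ cvgf; rewrite /Rintegral.
apply: fine_cvg; rewrite fineK//; exact: integrable_fin_num.
Qed.

(** Both claims share one induction, since additivity for head and tail needs the integrability of
    the tail. *)
Lemma integrable_Rintegral_sum d' (T' : measurableType d') (nu : {measure set T' -> \bar R})
    (I : Type) (r : seq I) (Q : pred I) (f : I -> T' -> R) :
  (forall i, Q i -> nu.-integrable setT (EFin \o f i)) ->
  nu.-integrable setT (EFin \o (fun w => \sum_(i <- r | Q i) f i w)) /\
  \int[nu]_w (\sum_(i <- r | Q i) f i w) = \sum_(i <- r | Q i) \int[nu]_w f i w.
Proof.
move=> fi; elim: r => [|i r [IHi IHe]].
  rewrite big_nil; split.
    by under eq_fun do rewrite big_nil; exact: integrable0.
  by under eq_Rintegral do rewrite big_nil; rewrite /Rintegral integral0.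
have [Qi|Qi] := boolP (Q i); last first.
  rewrite big_cons (negbTE Qi); split.
    by under eq_fun do rewrite big_cons (negbTE Qi).
  by under eq_Rintegral do rewrite big_cons (negbTE Qi).
rewrite big_cons Qi -IHe -RintegralD//; last exact: fi.
split; last by apply: eq_Rintegral => w _; rewrite big_cons Qi.
under eq_fun do rewrite big_cons Qi.
exact: (integrableD measurableT (fi i Qi) IHi).
Qed.

Lemma measurable_cos_comp d (T : measurableType d) (f : T -> R) :
  measurable_fun setT f -> measurable_fun setT (fun x => cos (f x)).
Proof. exact: (measurableT_comp (continuous_measurable_fun (@continuous_cos R))). Qed.

Lemma integrableM_cos d (T : measurableType d) (nu : {measure set T -> \bar R})
    (f g : T -> R) :
  nu.-integrable setT (EFin \o f) -> measurable_fun setT g ->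
  nu.-integrable setT (EFin \o (fun x => f x * cos (g x))).
Proof.
move=> intf mg; apply: (le_integrable measurableT _ _ intf).
  apply/measurable_EFinP; apply: measurable_funM; last exact: measurable_cos_comp.
  by apply/measurable_EFinP; exact: measurable_int intf.
move=> x _ /=; rewrite lee_fin normrM ler_piMr//.
by rewrite ler_norml cos_geN1 cos_le1.
Qed.

(** The integrand may change sign, so the half-line is reached from bounded intervals by dominated
    convergence, with |f| as the majorant. At 0 only right continuity of [F] is asked, because the
    derivative of the gamma kernel is computed for u > 0 only. *)
Lemma Rintegral_FTCy (f F : R -> R) (l : R) :
  (forall x : R, 0 < x -> is_derive x (1 : R) F (f x)) ->
  F x @[x --> (0 : R)^'+] --> F 0 -> continuous f ->
  mu.-integrable `[0, +oo[ (EFin \o f) ->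
  F x @[x --> +oo%R] --> l ->
  \int[mu]_(x in `[0, +oo[) f x = l - F 0.
Proof.
move=> dF F0 cf intf Fl.
have mf : measurable_fun setT f by exact: continuous_measurable_fun.
(* [n.+1] rather than [n]: the fundamental theorem needs a nondegenerate interval. *)
have Fn (n : nat) : \int[mu]_x (f \_ `[0, n.+1%:R]) x = F n.+1%:R - F 0.
  rewrite -Rintegral_mkcond /Rintegral (@continuous_FTC2 _ _ F)//.
  - exact: continuous_subspaceT.
  - split => //.
      move=> x; rewrite in_itv/= => /andP[x0 _].
      exact: (@ex_derive _ _ _ _ _ _ _ (dF _ x0)).
    apply: cvg_at_left_filter; apply: differentiable_continuous.
    by apply/derivable1_diffP; exact: (@ex_derive _ _ _ _ _ _ _ (dF _ (ltr0Sn _ n))).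
  - by move=> x; rewrite in_itv/= => /andP[x0 _]; rewrite derive1E; case: (dF _ x0).
have FnF : \int[mu]_x (f \_ `[0, n.+1%:R]) x @[n --> \oo] --> l - F 0.
  under eq_fun do rewrite Fn.
  apply: cvgB; last exact: cvg_cst.
  by apply: (cvg_comp _ _ _ Fl); rewrite (cvg_shiftS (fun n : nat => n%:R : R)); exact: cvgr_idn.
rewrite Rintegral_mkcond; apply: (cvg_unique _ _ FnF) => //.
apply: (@dominated_Rintegral _ _ mu _ _ (fun x => `|(f \_ `[0, +oo[) x|)).
- by move=> n; apply/(measurable_restrictT _ _).1 => //; exact: measurable_funTS.
- by apply/(measurable_restrictT _ _).1 => //; exact: measurable_funTS.
- move=> x; apply: cvg_near_cst; near=> n.
  rewrite !patchE !mem_setE !in_itv/= andbT.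
  case: (leP 0 x) => //= x0; rewrite ifT//.
  near: n; exists (Num.truncn `|x|).+1 => // n /= xn.
  rewrite (le_trans (ler_norm _))// (le_trans (ltW (truncnS_gt _)))// ler_nat.
  exact: (leq_trans xn).
- rewrite (_ : EFin \o _ = abse \o (EFin \o (f \_ `[0, +oo[)))//; apply: integrable_abse.
  rewrite -restrict_EFin; apply/integrable_restrict => //.
  by rewrite setTI.
- move=> n x; rewrite !patchE !mem_setE !in_itv/= andbT.
  by case: (leP 0 x) => //= x0; case: ifP => //; rewrite normr0.
Unshelve. all: by end_near. Qed.

End Rintegral_limits.

Section integrability.
Context {R : realType}.
Notation mu := (@lebesgue_measure R).

(** The restriction of [g] to the half-line plus its reflection dominates [f]. Integrability on the
    line is thus reduced to the half-line, where primitives are explicit. *)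
Lemma integrable_le_norm_arg (f g : R -> R) : measurable_fun setT f ->
  mu.-integrable `[0, +oo[ (EFin \o g) ->
  (forall t, `|f t| <= g `|t|) -> mu.-integrable setT (EFin \o f).
Proof.
move=> mf ig fg.
have ig0 : mu.-integrable setT (EFin \o (g \_ `[0, +oo[)).
  by rewrite -restrict_EFin; apply/integrable_restrict => //; rewrite setTI.
have igN := integrable_comp_scaling (@oppr_measurable _ _) ltr01 lebesgue_measure_opp ig0.
apply: (le_integrable _ _ _ (integrableD _ (integrable_abse ig0) (integrable_abse igN))) => //.
  exact/measurable_EFinP.
move=> t _ /=; rewrite lee_fin [leRHS]ger0_norm; last exact: addr_ge0.
rewrite !patchE !mem_setE !in_itv/= !andbT oppr_ge0.
have := fg t; case: (ltgtP 0 t) => t0 ft.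
- by rewrite normr0 addr0 (le_trans ft)// gtr0_norm// ler_norm.
- by rewrite normr0 add0r (le_trans ft)// ltr0_norm// ler_norm.
- by move: ft; rewrite -t0 oppr0 normr0 => ft; rewrite (le_trans ft)// (le_trans (ler_norm _))// lerDl.
Qed.

(** For a nonnegative integrand a limit of the primitive already yields the integrability that
    [Rintegral_FTCy] takes as a hypothesis. *)
Lemma integrable_FTC2y (f F : R -> R) (l : R) :
  (forall x : R, 0 <= x -> 0 <= f x) -> continuous f ->
  (forall x : R, 0 < x -> is_derive x (1 : R) F (f x)) ->
  F x @[x --> (0 : R)^'+] --> F 0 -> F x @[x --> +oo%R] --> l ->
  mu.-integrable `[0, +oo[ (EFin \o f).
Proof.
move=> f0 cf dF F0 Fl; apply/integrableP; split.
  by apply/measurable_EFinP; apply: measurable_funTS; exact: continuous_measurable_fun.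
rewrite (@eq_integral _ _ _ mu _ (EFin \o f)); last first.
  by move=> x; rewrite mem_setE in_itv/= andbT => x0 /=; rewrite ger0_norm// f0.
rewrite (@ge0_continuous_FTC2y _ f F 0 l)//; first by rewrite ltry.
- exact: continuous_subspaceT.
- by move=> x x0; exact: (@ex_derive _ _ _ _ _ _ _ (dF _ x0)).
- by move=> x; rewrite in_itv/= andbT => x0; rewrite derive1E; case: (dF _ x0).
Qed.

Lemma is_derive_continuous (F : R -> R) (x d : R) : is_derive x 1 F d ->
  {for x, continuous F}.
Proof.
by move=> [dF _]; apply: differentiable_continuous; exact/derivable1_diffP.
Qed.

Lemma is_derive_cvg_right (F : R -> R) (x d : R) : is_derive x 1 F d ->
  F y @[y --> x^'+] --> F x.
Proof.
by move=> dF; apply: cvg_at_right_filter; exact: is_derive_continuous dF.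
Qed.

Lemma expRM_cvgy (c : R) : 0 < c -> expR (- c * x) @[x --> +oo%R] --> (0 : R).
Proof.
move=> c0.
rewrite (_ : (fun x => _) = (fun x => expR (- x)) \o (fun x => c * x)); last first.
  by apply/funext => x /=; rewrite mulNr.
apply: cvg_comp (@cvgr_expR R).
by apply: (gt0_cvgMry c0); exact: cvg_id.
Qed.

Lemma integrable_expRy (c : R) : 0 < c ->
  mu.-integrable `[0, +oo[ (EFin \o (fun x => expR (- c * x))).
Proof.
move=> c0.
have dF x : is_derive x (1 : R) (fun x => - c^-1 * expR (- c * x)) (expR (- c * x)).
  apply: is_derive_eq; rewrite /GRing.scale /=; field; lra.
apply: (@integrable_FTC2y _ (fun x => - c^-1 * expR (- c * x)) (- c^-1 * 0)) => //.
- move=> x; apply: (@is_derive_continuous (fun x => expR (- c * x)) x (- c * expR (- c * x))).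
  by apply: is_derive_eq; rewrite /GRing.scale /=; ring.
- exact: (is_derive_cvg_right (dF 0)).
- by apply: cvgMr; exact: expRM_cvgy.
Qed.

End integrability.

(** * Abel and Cauchy kernels *)

Section Abel_Cauchy_kernels.
Context {R : realType}.
Notation mu := (@lebesgue_measure R).

Lemma expR_dominated_cvgy (F : R -> R) (K c : R) : 0 < c ->
  (forall x, 0 <= x -> `|F x| <= K * expR (- c * x)) ->
  F x @[x --> +oo%R] --> (0 : R).
Proof.
move=> c0 FK; apply/norm_cvg0P.
apply: (@squeeze_cvgr _ _ _ _ (cst 0) (fun x => K * expR (- c * x))).
- near=> x; rewrite normr_ge0 /=; apply: FK.
  by near: x; exact: nbhs_pinfty_ge.
- exact: cvg_cst.
- by rewrite -[X in _ --> X](mulr0 K); apply: cvgMr; exact: expRM_cvgy.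
Unshelve. all: by end_near. Qed.

Lemma integrable_expR_norm (c : R) : 0 < c ->
  mu.-integrable setT (EFin \o (fun x => expR (- c * `|x|))).
Proof.
move=> c0; apply: (integrable_le_norm_arg _ (integrable_expRy c0)).
  by apply: measurableT_comp => //; apply: measurable_funM => //.
by move=> t; rewrite ger0_norm ?expR_ge0.
Qed.

Lemma integrable_expR_cos (c y : R) : 0 < c ->
  mu.-integrable setT (EFin \o (fun t => expR (- c * `|t|) * cos (y * t))).
Proof.
move=> c0; apply: integrableM_cos (integrable_expR_norm c0) _.
exact: mulrl_measurable.
Qed.

Lemma Rintegral_expR_cos (c y : R) : 0 < c ->
  \int[mu]_t (expR (- c * `|t|) * cos (y * t)) = 2 * (c / (c ^+ 2 + y ^+ 2)).
Proof.
move=> c0; have cy0 : c ^+ 2 + y ^+ 2 != 0.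
  by rewrite gt_eqF// ltr_wpDr ?sqr_ge0// exprn_gt0.
have icos := integrable_expR_cos y c0.
rewrite Rintegral_even//; last by move=> x; rewrite normrN mulrN cosN.
congr (_ * _).
(* The real part of the primitive e^((iy - c)t) / (iy - c). *)
pose F t := (c ^+ 2 + y ^+ 2)^-1 * (expR (- c * t) * (y * sin (y * t) - c * cos (y * t))).
have dF x : is_derive x (1 : R) F (expR (- c * x) * cos (y * x)).
  by apply: is_derive_eq; rewrite /GRing.scale /=; field.
have E : {in `[0, +oo[%classic, (fun t => expR (- c * `|t|) * cos (y * t)) =1
    (fun t => expR (- c * t) * cos (y * t))}.
  by move=> t; rewrite mem_setE in_itv/= andbT => t0; rewrite ger0_norm.
rewrite Rintegral_itv_obnd_cbnd; last exact: integrableS icos.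
transitivity (\int[mu]_(t in `[0, +oo[) (expR (- c * t) * cos (y * t))).
  exact: eq_Rintegral.
rewrite (@Rintegral_FTCy _ _ F 0).
- by rewrite /F !mulr0 expR0 sin0 cos0; field.
- exact: is_derive_cvg_right (dF 0).
- move=> x; apply: (@is_derive_continuous _ (fun t => expR (- c * t) * cos (y * t)) x
    (expR (- c * x) * (- c * cos (y * x) - y * sin (y * x)))).
  by apply: is_derive_eq; rewrite /GRing.scale /=; ring.
- have icos0 : mu.-integrable `[0, +oo[ (EFin \o (fun t => expR (- c * `|t|) * cos (y * t))).
    exact: integrableS icos.
  apply: eq_integrable icos0 => // x x0.
  by rewrite /= (E x x0).
- apply: (@expR_dominated_cvgy _ ((c ^+ 2 + y ^+ 2)^-1 * (`|y| + c)) c) => // x x0.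
  rewrite /F normrM ger0_norm ?invr_ge0 ?addr_ge0 ?sqr_ge0// -mulrA ler_wpM2l//.
    by rewrite invr_ge0 addr_ge0 ?sqr_ge0.
  rewrite mulrC normrM (ger0_norm (expR_ge0 _)) ler_wpM2r ?expR_ge0//.
  rewrite (le_trans (ler_normB _ _))// !normrM (gtr0_norm c0) lerD// ler_piMr//.
  + by rewrite ler_norml sin_geN1 sin_le1.
  + exact: ltW.
  + by rewrite ler_norml cos_geN1 cos_le1.
Qed.

Lemma continuous_cauchy_kernel : continuous (fun x : R => (1 + x ^+ 2)^-1).
Proof.
move=> x; apply: cvgV; first by rewrite gt_eqF// ltr_pwDl ?sqr_ge0.
by apply: cvgD; [exact: cvg_cst|apply: exprn_continuous].
Qed.

Lemma integrable_cauchy_kernel :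
  mu.-integrable setT (EFin \o (fun x => (1 + x ^+ 2)^-1)).
Proof.
apply: (@integrable_le_norm_arg _ _ (fun x => (1 + x ^+ 2)^-1)).
- exact: continuous_measurable_fun continuous_cauchy_kernel.
- apply: (@integrable_FTC2y _ _ atan (pi / 2)).
  + by move=> x _; rewrite invr_ge0 addr_ge0 ?sqr_ge0.
  + exact: continuous_cauchy_kernel.
  + exact: is_derive_cvg_right (is_derive1_atan 0).
  + exact: cvgy_atan.
- by move=> t; rewrite real_normK ?num_real// ger0_norm// invr_ge0 addr_ge0 ?sqr_ge0.
Qed.

Lemma Rintegral_cauchy_kernel : \int[mu]_x (1 + x ^+ 2)^-1 = pi.
Proof.
rewrite Rintegral_even; [|exact: integrable_cauchy_kernel|by move=> x; rewrite sqrrN].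
rewrite Rintegral_itv_obnd_cbnd; last exact: integrableS integrable_cauchy_kernel.
rewrite (@Rintegral_FTCy _ _ atan (pi / 2)).
- by rewrite atan0 subr0 mulrC divfK.
- exact: is_derive_cvg_right (is_derive1_atan 0).
- exact: continuous_cauchy_kernel.
- exact: integrableS integrable_cauchy_kernel.
- exact: cvgy_atan.
Qed.

End Abel_Cauchy_kernels.

(** * Fourier transform of the gamma kernel *)

Section gamma_kernel.
Context {R : realType}.
Notation mu := (@lebesgue_measure R).

(** [powR] equals 1 on negative bases, hence the truncation of the base at 0. *)
Definition gamma_kernel (p s u : R) : R := Num.max u 0 `^ p * expR (- s * u).

Lemma gamma_kernel_ge0 (p s u : R) : 0 <= gamma_kernel p s u.
Proof. by rewrite mulr_ge0 ?powR_ge0 ?expR_ge0. Qed.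

Lemma gamma_kernel_le0 (p s u : R) : 0 < p -> u <= 0 -> gamma_kernel p s u = 0.
Proof. by move=> p0 u0; rewrite /gamma_kernel max_r// powR0 ?gt_eqF// mul0r. Qed.

Lemma gamma_kernel_gt0E (p s u : R) : 0 < u ->
  gamma_kernel p s u = u `^ p * expR (- s * u).
Proof. by move=> u0; rewrite /gamma_kernel max_l// ltW. Qed.

Lemma gamma_kernelS (p s u : R) : 0 < p ->
  gamma_kernel (p + 1) s u = u * gamma_kernel p s u.
Proof.
move=> p0; have [u0|u0] := leP u 0.
  by rewrite !gamma_kernel_le0 ?mulr0// addr_gt0.
rewrite !gamma_kernel_gt0E// powRD ?(gt_eqF u0) ?implybT//.
by rewrite powRr1 ?ltW//; ring.
Qed.

Lemma gamma_kernel_scale (p s u : R) : 0 < s ->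
  gamma_kernel p s (s^-1 * u) = s `^ (- p) * gamma_kernel p 1 u.
Proof.
move=> s0; rewrite /gamma_kernel.
have -> : Num.max (s^-1 * u) 0 = s^-1 * Num.max u 0.
  by rewrite -[in LHS](mulr0 s^-1) maxr_pMr// invr_ge0 ltW.
rewrite powRM ?invr_ge0 ?le_max ?lexx ?orbT ?(ltW s0)//.
rewrite -powR_inv1 ?ltW// -powRrM mulN1r mulrA; congr (_ * expR _).
by rewrite powR_inv1 ?ltW//; field; rewrite gt_eqF.
Qed.

Lemma gamma_kernel_expR_bound (p s : R) : 0 < p -> 0 < s ->
  exists2 K, 0 <= K &
    forall u, gamma_kernel p s u <= K * expR (- (s / 2) * `|u|).
Proof.
(* From ln (k u) <= k u follows u^p <= k^(-p) e^(p k u). This [k] makes p k u = s u / 2, so the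
   power uses up half of the decay e^(-su). *)
move=> p0 s0; pose k := s / (2 * p).
have k0 : 0 < k by rewrite divr_gt0// mulr_gt0.
exists (expR (- p * ln k)); first exact: expR_ge0.
move=> u; have [u0|u0] := leP u 0.
  by rewrite gamma_kernel_le0// mulr_ge0 ?expR_ge0.
rewrite gamma_kernel_gt0E// /powR gt_eqF// gtr0_norm// -!expRD ler_expR.
have := ln_sublinear (mulr_gt0 k0 u0); rewrite lnM ?posrE// => /ltW lnku.
have : p * (ln k + ln u) <= p * (k * u) by rewrite ler_wpM2l// ltW.
have -> : p * (k * u) = s / 2 * u by rewrite /k; field; rewrite gt_eqF.
by lra.
Qed.

(** The exponent p + 1 ensures that both terms of the derivative are gamma kernels of positive
    exponent, hence continuous and, for s > 0, integrable. *)
Lemma is_derive_gamma_kernel (p s u : R) : 0 < p -> 0 < u ->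
  is_derive u 1 (gamma_kernel (p + 1) s)
    ((p + 1) * gamma_kernel p s u - s * gamma_kernel (p + 1) s u).
Proof.
move=> p0 u0.
have near_u : \near u, (fun u => u `^ (p + 1) * expR (- s * u)) u = gamma_kernel (p + 1) s u.
  near=> x; rewrite gamma_kernel_gt0E//; near: x; exact: lt_nbhsr.
apply: (near_eq_is_derive near_u).
have := is_derive1_powR (p + 1) u0 => d1.
apply: is_derive_eq; rewrite /GRing.scale /=.
by rewrite !gamma_kernel_gt0E// (_ : p + 1 - 1 = p); [ring|ring].
Unshelve. all: by end_near. Qed.

Lemma continuous_gamma_kernel (p s : R) : 0 < p -> continuous (gamma_kernel p s).
Proof.
move=> p0 u.
have cexp : {for u, continuous (fun u : R => expR (- s * u))}.
  apply: (@is_derive_continuous _ (fun u => expR (- s * u)) u (- s * expR (- s * u))).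
  by apply: is_derive_eq; rewrite /GRing.scale /=; ring.
suff cpow : {for u, continuous (fun v : R => Num.max v 0 `^ p)} by exact: cvgM cpow cexp.
have [u0|u0|->] := ltgtP u 0.
- have near0 : \near u, cst 0 u = Num.max u 0 `^ p.
    near=> x; rewrite max_r ?powR0 ?gt_eqF//.
    by apply: ltW; near: x; exact: lt_nbhsl.
  apply: (cvg_trans (near_eq_cvg near0)).
  by rewrite max_r ?powR0 ?gt_eqF ?(ltW u0)//; exact: cvg_cst.
- have nearu : \near u, u `^ p = Num.max u 0 `^ p.
    by near=> x; rewrite max_l//; apply: ltW; near: x; exact: lt_nbhsr.
  apply: (cvg_trans (near_eq_cvg nearu)).
  rewrite max_l ?(ltW u0)//; exact: (is_derive_continuous (is_derive1_powR p u0)).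
- apply/left_right_continuousP; rewrite maxxx powR0 ?gt_eqF//; split.
  + have near0 : \forall u \near (0 : R)^'-, cst 0 u = Num.max u 0 `^ p.
      near=> x; rewrite max_r ?powR0 ?gt_eqF//.
    apply: (cvg_trans (near_eq_cvg near0)); exact: cvg_cst.
  + have nearu : \forall u \near (0 : R)^'+, u `^ p = Num.max u 0 `^ p.
      by near=> x; rewrite max_l.
    apply: (cvg_trans (near_eq_cvg nearu)); exact: powR_cvg0.
Unshelve. all: by end_near. Qed.

End gamma_kernel.

Section gamma_transform.
Context {R : realType}.
Notation mu := (@lebesgue_measure R).

Lemma measurable_gamma_kernel (p s : R) : 0 < p ->
  measurable_fun setT (gamma_kernel p s).
Proof. by move=> p0; apply: continuous_measurable_fun; exact: continuous_gamma_kernel. Qed.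

Lemma integrable_gamma_kernel (p s : R) : 0 < p -> 0 < s ->
  mu.-integrable setT (EFin \o gamma_kernel p s).
Proof.
move=> p0 s0; have [K K0 gK] := gamma_kernel_expR_bound p0 s0.
have s20 : 0 < s / 2 by rewrite divr_gt0.
apply: (le_integrable _ _ _ (integrableZl _ K (integrable_expR_norm s20))) => //.
  by apply/measurable_EFinP; exact: measurable_gamma_kernel.
move=> u _ /=; rewrite lee_fin ger0_norm ?gamma_kernel_ge0//.
by rewrite (le_trans (gK u))// ler_norm.
Qed.

Lemma integrable_gamma_kernel_cos (p s a b : R) : 0 < p -> 0 < s ->
  mu.-integrable setT (EFin \o (fun u => gamma_kernel p s u * cos (a * u + b))).
Proof.
move=> p0 s0; apply: integrableM_cos (integrable_gamma_kernel p0 s0) _.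
by apply: measurable_funD => //; exact: mulrl_measurable.
Qed.

Lemma Gamma_gamma_kernel (p : R) : 0 < p ->
  Gamma (p + 1) = \int[mu]_u gamma_kernel p 1 u.
Proof.
move=> p0; rewrite /Gamma -[LHS]/(\int[mu]_(x in `]0, +oo[) (x `^ (p + 1 - 1) * expR (- x))).
rewrite Rintegral_mkcond; apply: eq_Rintegral => u _.
rewrite patchE mem_setE in_itv/= andbT; case: ltP => u0.
  by rewrite gamma_kernel_gt0E// addrK mulN1r.
by rewrite gamma_kernel_le0.
Qed.

Lemma Rintegral_gamma_kernel (p s : R) : 0 < p -> 0 < s ->
  \int[mu]_u gamma_kernel p s u = Gamma (p + 1) * s `^ (- (p + 1)).
Proof.
move=> p0 s0; have is0 : 0 < s^-1 by rewrite invr_gt0.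
rewrite (Rintegral_affine 0 is0 (integrable_gamma_kernel p0 s0)).
under eq_Rintegral do rewrite addr0 gamma_kernel_scale//.
rewrite RintegralZl//; last exact: integrable_gamma_kernel.
rewrite -Gamma_gamma_kernel// mulrA mulrC; congr (_ * _).
rewrite -powR_inv1 ?ltW// -powRD ?(gt_eqF s0) ?implybT//.
by congr (_ `^ _); ring.
Qed.

(** The phase gives the cosine transform for [phi = 0] and the sine transform
    for [phi = - (pi / 2)], so that one lemma serves for both. *)
Definition gamma_transform (p s phi t : R) : R :=
  \int[mu]_u (gamma_kernel p s u * cos (t * u + phi)).

(** Differentiation under the integral sign: the factor u raises the exponent of the kernel by one,
    and differentiating the cosine advances its phase by a quarter turn. The kernel of exponent p +
    1 is a majorant independent of t. *)
Lemma is_derive_gamma_transform (p s phi t : R) : 0 < p -> 0 < s ->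
  is_derive t 1 (gamma_transform p s phi)
    (gamma_transform (p + 1) s (phi + pi / 2) t).
Proof.
move=> p0 s0; have p10 : 0 < p + 1 by rewrite addr_gt0.
pose f (t u : R) := gamma_kernel p s u * cos (t * u + phi).
have df x u : is_derive x (1 : R) (f ^~ u)
    (gamma_kernel (p + 1) s u * cos (x * u + (phi + pi / 2))).
  apply: is_derive_eq; rewrite /GRing.scale /= gamma_kernelS// addrA cosDpihalf; ring.
have d1f x u : partial1of2 f x u = gamma_kernel (p + 1) s u * cos (x * u + (phi + pi / 2)).
  by rewrite partial1of2E; case: (df x u).
have ift x : `](t - 1), (t + 1)[%classic x -> mu.-integrable setT (EFin \o f x).
  by move=> _; exact: integrable_gamma_kernel_cos.
have tin : `](t - 1), (t + 1)[%classic t by rewrite /= in_itv/=; lra.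
have der x y : `](t - 1), (t + 1)[%classic x -> [set: R] y -> derivable (f ^~ y) x 1.
  by move=> _ _; case: (df x y).
have ub x y : `](t - 1), (t + 1)[%classic x -> [set: R] y ->
    `|partial1of2 f x y| <= gamma_kernel (p + 1) s y.
  move=> _ _; rewrite d1f normrM (ger0_norm (gamma_kernel_ge0 _ _ _)).
  by rewrite ler_piMr ?gamma_kernel_ge0// ler_norml cos_geN1 cos_le1.
have ig := integrable_gamma_kernel p10 s0.
split.
  exact: (derivable_under_integral measurableT tin ift der (gamma_kernel_ge0 _ _) ig ub).
have := differentiation_under_integral measurableT tin ift der (gamma_kernel_ge0 _ _) ig ub.
rewrite derive1E => ->.
by apply: eq_Rintegral => u _; rewrite d1f.
Qed.

(** The derivative in u of [gamma_kernel (p + 1) s u * cos (t * u + phi)] has integral 0, since the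
    product vanishes at 0 and at infinity. If G_p denotes the Fourier transform of the kernel of
    exponent p, the complex form is (p + 1) G_p = z G_(p+1) with z = s + it. *)
Lemma gamma_transform_by_parts (p s phi t : R) : 0 < p -> 0 < s ->
  (p + 1) * gamma_transform p s phi t =
  s * gamma_transform (p + 1) s phi t - t * gamma_transform (p + 1) s (phi + pi / 2) t.
Proof.
move=> p0 s0; have p10 : 0 < p + 1 by rewrite addr_gt0.
pose F u := gamma_kernel (p + 1) s u * cos (t * u + phi).
pose f u := (p + 1) * (gamma_kernel p s u * cos (t * u + phi))
  + (- s * (gamma_kernel (p + 1) s u * cos (t * u + phi))
  + t * (gamma_kernel (p + 1) s u * cos (t * u + (phi + pi / 2)))).
have iZ q k phi' : 0 < q -> mu.-integrable setT
    (EFin \o (fun u => k * (gamma_kernel q s u * cos (t * u + phi')))).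
  by move=> q0; exact: (integrableZl measurableT k (integrable_gamma_kernel_cos t phi' q0 s0)).
have i23 := integrableD measurableT (iZ _ (- s) phi p10) (iZ _ t (phi + pi / 2) p10).
have iF := integrableD measurableT (iZ p (p + 1) phi p0) i23.
have ccos phi' : continuous (fun u : R => cos (t * u + phi')).
  move=> u; apply: (@is_derive_continuous _ (fun u => cos (t * u + phi')) u (- t * sin (t * u + phi'))).
  by apply: is_derive_eq; rewrite /GRing.scale /=; ring.
have cgc q phi' : 0 < q -> continuous (fun u : R => gamma_kernel q s u * cos (t * u + phi')).
  by move=> q0 u; apply: cvgM; [exact: continuous_gamma_kernel|exact: ccos].
have cf : continuous f.
  move=> u; apply: cvgD; [|apply: cvgD]; apply: cvgMr; exact: cgc.
have int0 : \int[mu]_(u in `[0, +oo[) f u = 0 - F 0.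
  apply: Rintegral_FTCy => //.
  - move=> u u0; have dg := is_derive_gamma_kernel s p0 u0.
    apply: is_derive_eq; rewrite /GRing.scale /= /f [_ + (phi + _)]addrA cosDpihalf; ring.
  - exact/cvg_at_right_filter/cgc.
  - exact: integrableS iF.
  - have [K K0 gK] := gamma_kernel_expR_bound p10 s0.
    apply: (@expR_dominated_cvgy _ _ K (s / 2)); first by rewrite divr_gt0.
    move=> x x0; rewrite normrM (ger0_norm (gamma_kernel_ge0 _ _ _)).
    rewrite (le_trans _ (le_trans (gK x) _))//; last by rewrite ger0_norm.
    by rewrite ler_piMr ?gamma_kernel_ge0// ler_norml cos_geN1 cos_le1.
have fE : \int[mu]_u f u = 0.
  transitivity (\int[mu]_(u in `[0, +oo[) f u); last first.
    by rewrite int0 /F gamma_kernel_le0// mul0r subr0.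
  rewrite [RHS]Rintegral_mkcond; apply: eq_Rintegral => u _.
  rewrite patchE mem_setE in_itv/= andbT; case: leP => // /ltW u0.
  by rewrite /f !gamma_kernel_le0// !mul0r !mulr0 !addr0.
move: fE; rewrite /f RintegralD//; [|exact: iZ].
rewrite RintegralD//; [|exact: iZ|exact: iZ].
rewrite !RintegralZl//; try exact: integrable_gamma_kernel_cos.
by rewrite -!/(gamma_transform _ _ _ _); lra.
Qed.

Lemma gamma_transform_polar (p s phi t : R) : 0 < p -> 0 < s ->
  gamma_transform p s phi t =
  cos phi * gamma_transform p s 0 t - sin phi * gamma_transform p s (- (pi / 2)) t.
Proof.
move=> p0 s0; have ic b := integrable_gamma_kernel_cos t b p0 s0.
rewrite -!RintegralZl// -RintegralB//; last 2 first.
- exact: (integrableZl measurableT (cos phi) (ic 0)).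
- exact: (integrableZl measurableT (sin phi) (ic (- (pi / 2)))).
apply: eq_Rintegral => u _; rewrite addr0 cosD cosBpihalf; ring.
Qed.

Lemma sqrD_gt0 (s x : R) : 0 < s -> 0 < s ^+ 2 + x ^+ 2.
Proof. by move=> s0; rewrite ltr_pwDl ?sqr_ge0// exprn_gt0. Qed.

(** [invmod s b t] is |s + it|^(-b). *)
Definition invmod (s b t : R) : R := expR (- (b / 2) * ln (s ^+ 2 + t ^+ 2)).

Lemma gamma_transformE (p s phi t : R) : 0 < p -> 0 < s ->
  gamma_transform p s phi t =
  Gamma (p + 1) * invmod s (p + 1) t * cos ((p + 1) * atan (t / s) + phi).
Proof.
move=> p0 s0; set a := p + 1.
have pos x := sqrD_gt0 x s0.
pose C := gamma_transform p s 0; pose S := gamma_transform p s (- (pi / 2)).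
pose C1 := gamma_transform a s 0; pose S1 := gamma_transform a s (- (pi / 2)).
have G1 x : gamma_transform a s (0 + pi / 2) x = - S1 x.
  rewrite gamma_transform_polar ?addr_gt0// add0r cos_pihalf sin_pihalf.
  by rewrite mul0r mul1r sub0r.
have G2 : gamma_transform a s (- (pi / 2) + pi / 2) = C1 by rewrite addNr.
have dC x : is_derive x (1 : R) C (- S1 x).
  by rewrite -G1; exact: is_derive_gamma_transform.
have dS x : is_derive x (1 : R) S (C1 x).
  by rewrite -G2; exact: is_derive_gamma_transform.
have ibpC x : a * C x = s * C1 x + x * S1 x.
  by rewrite (gamma_transform_by_parts 0 x p0 s0) G1 mulrN opprK.
have ibpS x : a * S x = s * S1 x - x * C1 x.
  by rewrite (gamma_transform_by_parts _ x p0 s0) G2.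
pose L x := ln (s ^+ 2 + x ^+ 2); pose th x := atan (x / s).
have dL x : is_derive x (1 : R) L (2 * x / (s ^+ 2 + x ^+ 2)).
  have dln := is_derive1_ln (pos x).
  apply: is_derive_eq; rewrite /GRing.scale /=; field; exact: lt0r_neq0.
have dth x : is_derive x (1 : R) th (s / (s ^+ 2 + x ^+ 2)).
  apply: is_derive_eq; rewrite /GRing.scale /=; field.
  by rewrite !lt0r_neq0.
(* [W] is the real part of z^a G e^(-i(phi + a th t)), where z = s + ix and G is
   the Fourier transform of the gamma kernel at x. *)
pose psi x := a * th t + phi - a * th x.
pose W x := expR (a / 2 * L x) * (C x * cos (psi x) - S x * sin (psi x)).
have dW x : is_derive x (1 : R) W 0.
  apply: is_derive_eq; rewrite /GRing.scale /=.
  have Q0 : s ^+ 2 + x ^+ 2 != 0 by exact: lt0r_neq0.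
  (* Grouped so that [C] and [S] occur only in the products with [a]: substituting [ibpC] and [ibpS]
     makes both brackets vanish. *)
  transitivity (expR (a / 2 * L x) / (s ^+ 2 + x ^+ 2) *
    (cos (psi x) * (s * (a * S x) + x * (a * C x) - (s ^+ 2 + x ^+ 2) * S1 x) +
     sin (psi x) * (s * (a * C x) - x * (a * S x) - (s ^+ 2 + x ^+ 2) * C1 x))).
    by field.
  by rewrite ibpC ibpS; ring.
have C0 : C 0 = Gamma a * s `^ (- a).
  rewrite -Rintegral_gamma_kernel//; apply: eq_Rintegral => u _.
  by rewrite mul0r addr0 cos0 mulr1.
have S0 : S 0 = 0.
  transitivity (\int[mu]_u (0 * gamma_kernel p s u)).
    by apply: eq_Rintegral => u _; rewrite mul0r add0r cosN cos_pihalf mulr0 mul0r.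
  by rewrite RintegralZl ?mul0r//; exact: integrable_gamma_kernel.
have EL x : expR (a / 2 * L x) * invmod s a x = 1.
  by rewrite /invmod -/(L x) -expRD -mulrDl subrr mul0r expR0.
have sa : expR (a / 2 * L 0) * s `^ (- a) = 1.
  rewrite /L expr0n addr0 lnXn// /powR gt_eqF// -expRD -[RHS]expR0; congr expR.
  by rewrite mulr2n; field.
(* The angle [psi] equals phi at x = t, so [W t] is |s + it|^a times the transform sought; at x = 0
   the sine part vanishes and [W 0] is Gamma(a) cos (a atan (t/s) + phi). *)
have : W t = W 0 by exact: is_derive_0_is_cst.
rewrite /W C0 S0 mul0r subr0 /psi /th mul0r atan0 mulr0 subr0.
have -> : a * atan (t / s) + phi - a * atan (t / s) = phi by ring.
move=> Wt; rewrite gamma_transform_polar//.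
transitivity (invmod s a t * (expR (a / 2 * L t) * (C t * cos phi - S t * sin phi))).
  by rewrite mulrA [invmod _ _ _ * _]mulrC EL mul1r /C /S; ring.
rewrite Wt; transitivity (expR (a / 2 * L 0) * s `^ (- a) *
  (Gamma a * invmod s a t * cos (a * atan (t / s) + phi))); first by ring.
by rewrite sa mul1r.
Qed.

End gamma_transform.

(** * Fourier inversion *)

Section dominated_Fubini.
Context {R : realType} d1 d2 (T1 : measurableType d1) (T2 : measurableType d2).
Variables (m1 : {sigma_finite_measure set T1 -> \bar R}).
Variables (m2 : {sigma_finite_measure set T2 -> \bar R}).
Variables (f : T1 * T2 -> R) (g : T1 -> R) (h : T2 -> R).
Hypothesis mf : measurable_fun setT f.
Hypothesis ig : m1.-integrable setT (EFin \o g).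
Hypothesis ih : m2.-integrable setT (EFin \o h).
Hypothesis fgh : forall x y, `|f (x, y)| <= g x * h y.

Let mef : measurable_fun setT (EFin \o f).
Proof. exact/measurable_EFinP. Qed.

Lemma dominated_integrable1 x : m2.-integrable setT (EFin \o (fun y => f (x, y))).
Proof.
apply: (le_integrable measurableT _ _ (integrableZl measurableT (g x) ih)).
  by apply/measurable_EFinP; apply: (measurableT_comp mf); exact: measurable_pair1.
by move=> y _ /=; rewrite lee_fin (le_trans (fgh x y))// ler_norm.
Qed.

Lemma dominated_integrable2 y : m1.-integrable setT (EFin \o (fun x => f (x, y))).
Proof.
apply: (le_integrable measurableT _ _ (integrableZl measurableT (h y) ig)).
  by apply/measurable_EFinP; apply: (measurableT_comp mf); exact: measurable_pair2.
by move=> x _ /=; rewrite lee_fin (le_trans (fgh x y))// mulrC ler_norm.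
Qed.

(** By Tonelli it is enough to bound the iterated integral of |f|, which is at most the product of
    the integrals of |g| and |h|. *)
Let imf : (m1 \x m2)%E.-integrable setT (EFin \o f).
Proof.
apply: (integrable12ltyP m1 m2 mef).2.
apply: (@le_lt_trans _ _ (\int[m1]_x ((\int[m2]_y `|h y|%:E) * `|(g x)%:E|))%E).
  apply: ge0_le_integral => //.
  - by move=> x _; exact: integral_ge0.
  - apply: (measurable_fun_fubini_tonelli_F (abse \o (EFin \o f))) => //=.
    exact: measurableT_comp.
  - apply: measurable_funeM; apply: measurableT_comp => //.
    exact: measurable_int ig.
  - move=> x _; rewrite muleC -ge0_integralZl//; last first.
      by apply: measurableT_comp => //; apply: measurableT_comp => //;
        apply/measurable_EFinP; exact: measurable_int ih.
    apply: ge0_le_integral => //.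
    + apply: measurableT_comp => //; apply: (measurableT_comp mef).
      exact: measurable_pair1.
    + apply: measurable_funeM; apply: measurableT_comp => //.
      by apply: measurableT_comp => //;
        apply/measurable_EFinP; exact: measurable_int ih.
    + move=> y _ /=; rewrite lee_fin -normrM (le_trans (fgh x y))// ler_norm//.
have /integrableP[mh hoo] := ih; have /integrableP[mg goo] := ig.
rewrite ge0_integralZl//; last 2 first.
- exact: measurableT_comp.
- exact: integral_ge0.
by rewrite lte_mul_pinfty// ?integral_ge0// ge0_fin_numE ?integral_ge0.
Qed.

Lemma integrable_Rintegral1 :
  m1.-integrable setT (EFin \o (fun x => \int[m2]_y f (x, y))).
Proof.
apply: eq_integrable (integrable_fubini_F imf) => // x _.
by rewrite /= /fubini_F /Rintegral fineK//; exact: (integrable_fin_num _ (dominated_integrable1 x)).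
Qed.

Lemma dominated_Fubini :
  \int[m1]_x \int[m2]_y f (x, y) = \int[m2]_y \int[m1]_x f (x, y).
Proof.
rewrite /Rintegral; congr fine.
transitivity (\int[m1]_x \int[m2]_y (EFin \o f) (x, y))%E.
  by apply: eq_integral => x _; rewrite fineK//; exact: (integrable_fin_num _ (dominated_integrable1 x)).
rewrite (Fubini imf); apply: eq_integral => y _.
by rewrite fineK//; exact: (integrable_fin_num _ (dominated_integrable2 y)).
Qed.

End dominated_Fubini.

Section inversion.
Context {R : realType}.
Notation mu := (@lebesgue_measure R).

Lemma cvgry_ln : ln x @[x --> +oo%R] --> (+oo%R : set_system R).
Proof.
apply/cvgryPge => A; near=> x.
have x0 : 0 < x by near: x; exact: nbhs_pinfty_gt.
rewrite -ler_expR lnK ?posrE//; near: x; exact: nbhs_pinfty_ge.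
Unshelve. all: by end_near. Qed.

Lemma continuous_invmod (s b : R) : 0 < s -> continuous (invmod s b).
Proof.
move=> s0 x; have dln := is_derive1_ln (sqrD_gt0 x s0).
apply: (@is_derive_continuous _ (invmod s b) x (invmod s b x * (- b * x / (s ^+ 2 + x ^+ 2)))).
apply: is_derive_eq; rewrite /GRing.scale /= /invmod; field.
exact/lt0r_neq0/sqrD_gt0.
Qed.

Lemma invmod_ge0 (s b t : R) : 0 <= invmod s b t.
Proof. exact: expR_ge0. Qed.

Lemma measurable_invmod (s b : R) : 0 < s -> measurable_fun setT (invmod s b).
Proof. by move=> s0; apply: continuous_measurable_fun; exact: continuous_invmod. Qed.

(** The absolute value keeps the base at least s > 0 on the whole line, as [integrable_FTC2y] asks
    for continuity everywhere. The primitive tends to 0 at infinity because b > 1. *)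
Lemma integrable_power_tail (s b : R) : 0 < s -> 1 < b ->
  mu.-integrable `[0, +oo[ (EFin \o (fun t => expR (- b * ln (s + `|t|)))).
Proof.
move=> s0 b1; pose F t := (1 - b)^-1 * expR ((1 - b) * ln (s + t)).
have pos (x : R) : 0 <= x -> 0 < s + x by move=> x0; rewrite ltr_wpDr.
have dF (x : R) : 0 <= x -> is_derive x (1 : R) F (expR (- b * ln (s + `|x|))).
  move=> x0; have dln := is_derive1_ln (pos _ x0).
  apply: is_derive_eq; rewrite /GRing.scale /= ger0_norm//.
  rewrite mulrBl mul1r expRD lnK ?posrE ?pos// mulNr; field.
  by rewrite lt0r_neq0 ?pos//= subr_eq0 lt_eqF.
apply: (@integrable_FTC2y _ (fun t => expR (- b * ln (s + `|t|))) F ((1 - b)^-1 * 0)).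
- by move=> x _; exact: expR_ge0.
- move=> x; apply: continuous_comp; last exact: continuous_expR.
  apply: cvgMr; apply: continuous_comp; last exact/continuous_ln/pos.
  by apply: cvgD; [exact: cvg_cst|exact: norm_continuous].
- by move=> x /ltW; exact: dF.
- exact: (is_derive_cvg_right (dF 0 (lexx _))).
- apply: cvgMr.
  have b10 : 0 < b - 1 by rewrite subr_gt0.
  have := cvg_comp _ _ cvgry_ln (expRM_cvgy b10) => ln_lim.
  rewrite -opprB.
  apply: (cvg_comp (fun t => s + t) (fun y => expR (- (b - 1) * ln y)) _ ln_lim).
  exact: cvg_addrl.
Qed.

Lemma integrable_invmod (s b : R) : 0 < s -> 1 < b ->
  mu.-integrable setT (EFin \o invmod s b).
Proof.
move=> s0 b1.
(* (s + |t|)^2 <= 2 (s^2 + t^2), hence [invmod s b t <= 2^(b/2) (s + |t|)^(-b)]. *)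
have iK : mu.-integrable `[0, +oo[
    (EFin \o (fun t => expR (b / 2 * ln 2) * expR (- b * ln (s + `|t|)))).
  have mI : measurable (`[0, +oo[ : set (measurableTypeR R)) by [].
  exact: (integrableZl mI (expR (b / 2 * ln 2)) (integrable_power_tail s0 b1)).
apply: (integrable_le_norm_arg (measurable_invmod b s0) iK) => t /=.
rewrite normr_id ger0_norm ?invmod_ge0// /invmod -expRD ler_expR.
have st0 : 0 < s + `|t| by rewrite ltr_pwDl.
have st1 : (s + `|t|) ^+ 2 <= 2 * (s ^+ 2 + t ^+ 2).
  by rewrite -[t ^+ 2]real_normK ?num_real//; have := sqr_ge0 (s - `|t|); rewrite !expr2; nra.
have : ln ((s + `|t|) ^+ 2) <= ln (2 * (s ^+ 2 + t ^+ 2)).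
  by rewrite ler_ln ?posrE ?exprn_gt0// mulr_gt0 ?sqrD_gt0.
rewrite lnM ?posrE ?sqrD_gt0// lnXn// mulr2n => lnst.
have : b / 2 * (ln (s + `|t|) + ln (s + `|t|)) <= b / 2 * (ln 2 + ln (s ^+ 2 + t ^+ 2)).
  by rewrite ler_wpM2l// divr_ge0//; lra.
by lra.
Qed.

Lemma measurable_atan_div (s : R) : measurable_fun setT (fun t : R => atan (t / s)).
Proof.
apply: (measurableT_comp (continuous_measurable_fun (@continuous_atan R))).
exact: mulrr_measurable.
Qed.

Lemma integrable_invmod_cos (s b x c : R) : 0 < s -> 1 < b ->
  mu.-integrable setT
    (EFin \o (fun t => invmod s b t * cos (t * x - c * atan (t / s)))).
Proof.
move=> s0 b1; apply: integrableM_cos (integrable_invmod s0 b1) _.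
apply: measurable_funB; first exact: mulrr_measurable.
by apply: measurable_funM => //; exact: measurable_atan_div.
Qed.

Lemma gamma_kernel_bounded (p s : R) : 0 < p -> 0 < s ->
  exists2 K, 0 <= K & forall u, gamma_kernel p s u <= K.
Proof.
move=> p0 s0; have [K K0 gK] := gamma_kernel_expR_bound p0 s0.
exists K => // u; rewrite (le_trans (gK u))// ler_piMr// -expR0 ler_expR.
by rewrite mulNr oppr_le0 mulr_ge0// divr_ge0 ?ltW.
Qed.

(** An approximate identity in rescaled form: the Cauchy kernel stays fixed, with total mass 2 pi,
    and only the argument of the gamma kernel moves, so boundedness and continuity of the latter
    suffice. *)
Lemma cauchy_approximation (p s x : R) : 0 < p -> 0 < s ->
  \int[mu]_v (gamma_kernel p s (n.+1%:R^-1 * v + x) * (2 * (1 + v ^+ 2)^-1)) @[n --> \oo]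
    --> 2 * pi * gamma_kernel p s x.
Proof.
move=> p0 s0; have [K K0 gK] := gamma_kernel_bounded p0 s0.
have -> : 2 * pi * gamma_kernel p s x =
    \int[mu]_v (gamma_kernel p s x * (2 * (1 + v ^+ 2)^-1)).
  under eq_Rintegral do rewrite mulrA.
  rewrite RintegralZl//; last exact: integrable_cauchy_kernel.
  by rewrite Rintegral_cauchy_kernel; ring.
have mc : measurable_fun setT (fun v : R => 2 * (1 + v ^+ 2)^-1).
  apply: measurable_funM => //.
  exact: (continuous_measurable_fun continuous_cauchy_kernel).
apply: (@dominated_Rintegral _ _ _ mu _ _ (fun v => K * 2 * (1 + v ^+ 2)^-1)).
- move=> n; apply: measurable_funM => //.
  apply: (measurableT_comp (measurable_gamma_kernel s p0)).
  by apply: measurable_funD => //; exact: mulrl_measurable.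
- exact: measurable_funM.
- move=> v; apply: cvgMl; apply: continuous_cvg; first exact: continuous_gamma_kernel.
  rewrite -[X in _ --> X]add0r; apply: cvgD; last exact: cvg_cst.
  by rewrite -[X in _ --> X](mul0r v); apply: cvgMl; exact: cvg_harmonic.
- exact: (integrableZl measurableT (K * 2) integrable_cauchy_kernel).
- move=> n v.
  have c0 : 0 <= (1 + v ^+ 2)^-1 by rewrite invr_ge0 addr_ge0 ?sqr_ge0.
  have c20 : 0 <= 2 * (1 + v ^+ 2)^-1 by rewrite mulr_ge0.
  rewrite -(mulrA K) ger0_norm; last by rewrite mulr_ge0 ?gamma_kernel_ge0.
  by rewrite ler_wpM2r.
Qed.

(** The phase -(t x) stands for the inversion factor e^(itx). After Fubini the integral in t is a
    Cauchy kernel of width c centred at x, and u = c v + x normalizes it. *)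
Lemma Abel_mean_gamma_transform (p s x c : R) : 0 < p -> 0 < s -> 0 < c ->
  \int[mu]_t (expR (- c * `|t|) * gamma_transform p s (- (t * x)) t) =
  \int[mu]_v (gamma_kernel p s (c * v + x) * (2 * (1 + v ^+ 2)^-1)).
Proof.
move=> p0 s0 c0.
pose f (tu : measurableTypeR R * measurableTypeR R) : R :=
  expR (- c * `|tu.1|) * gamma_kernel p s tu.2 * cos ((tu.2 - x) * tu.1).
have mf : measurable_fun setT f.
  apply: measurable_funM; first apply: measurable_funM.
  - apply: measurableT_comp => //; apply: measurable_funM => //.
    by apply: measurableT_comp => //; exact: measurable_fst.
  - exact: (measurableT_comp (measurable_gamma_kernel s p0)).
  - apply: measurable_cos_comp; apply: measurable_funM => //.
    exact: measurable_funB.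
have fgh (t u : R) : `|f (t, u)| <= expR (- c * `|t|) * gamma_kernel p s u.
  have eg0 : 0 <= expR (- c * `|t|) * gamma_kernel p s u.
    by rewrite mulr_ge0 ?expR_ge0 ?gamma_kernel_ge0.
  by rewrite /f /= normrM (ger0_norm eg0) ler_piMr// ler_norml cos_geN1 cos_le1.
have ie := integrable_expR_norm c0.
have ig := integrable_gamma_kernel p0 s0.
transitivity (\int[mu]_t \int[mu]_u f (t, u)).
  apply: eq_Rintegral => t _; rewrite -RintegralZl//; last exact: integrable_gamma_kernel_cos.
  by apply: eq_Rintegral => u _; rewrite /f /= mulrA; congr (_ * cos _); ring.
rewrite (dominated_Fubini mf ie ig fgh).
pose k u := gamma_kernel p s u * (2 * (c / (c ^+ 2 + (u - x) ^+ 2))).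
have kE u : \int[mu]_t f (t, u) = k u.
  rewrite /k -Rintegral_expR_cos// -RintegralZl//; last exact: integrable_expR_cos.
  by apply: eq_Rintegral => t _; rewrite /f /=; ring.
have ik : mu.-integrable setT (EFin \o k).
  (* [integrable_Rintegral1] integrates out the second variable, so the variables are swapped to get
     integrability in u. *)
  pose f' (ut : measurableTypeR R * measurableTypeR R) := f (ut.2, ut.1).
  have mf' : measurable_fun setT f'.
    by apply: (measurableT_comp mf); exact: measurable_swap.
  have f'gh (u t : R) : `|f' (u, t)| <= gamma_kernel p s u * expR (- c * `|t|).
    by rewrite mulrC; exact: fgh.
  apply: eq_integrable (integrable_Rintegral1 mf' ig ie f'gh) => // u _.
  by rewrite /= -kE.
under eq_Rintegral do rewrite kE.
rewrite (Rintegral_affine x c0 ik) -RintegralZl//; last exact: integrable_affine.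
apply: eq_Rintegral => v _; rewrite /k; field.
by rewrite !lt0r_neq0// ?sqrD_gt0// ltr_pwDl ?sqr_ge0.
Qed.

(** The Abel means with c = 1/(n+1) have two limits: the right side through the Cauchy kernel, and
    the left side by dominated convergence with the integrable majorant |J|. *)
Lemma gamma_inversion (p s x : R) : 0 < p -> 0 < s ->
  Gamma (p + 1) *
    \int[mu]_t (invmod s (p + 1) t * cos (t * x - (p + 1) * atan (t / s))) =
  2 * pi * gamma_kernel p s x.
Proof.
move=> p0 s0; have p11 : 1 < p + 1 by rewrite ltrDr.
pose J t := Gamma (p + 1) * (invmod s (p + 1) t * cos (t * x - (p + 1) * atan (t / s))).
have JE t : gamma_transform p s (- (t * x)) t = J t.
  by rewrite gamma_transformE// /J -cosN -mulrA; congr (_ * (_ * cos _)); ring.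
have icos := integrable_invmod_cos x (p + 1) s0 p11.
have iJ : mu.-integrable setT (EFin \o J) by exact: (integrableZl measurableT _ icos).
have lim : \int[mu]_t (expR (- n.+1%:R^-1 * `|t|) * gamma_transform p s (- (t * x)) t)
    @[n --> \oo] --> 2 * pi * gamma_kernel p s x.
  under eq_fun do rewrite Abel_mean_gamma_transform//.
  exact: cauchy_approximation.
rewrite -RintegralZl//; apply: (cvg_unique _ _ lim) => //.
have mJ : measurable_fun setT J by apply/measurable_EFinP; exact: measurable_int iJ.
apply: (@dominated_Rintegral _ _ _ mu _ _ (fun t => `|J t|)).
- move=> n; under eq_fun do rewrite JE; apply: measurable_funM => //.
  by apply: measurableT_comp => //; apply: measurable_funM.
- exact: mJ.
- move=> t; suff lim1 : expR (- n.+1%:R^-1 * `|t|) * J t @[n --> \oo] --> 1 * J t.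
    by move: lim1; rewrite mul1r; under eq_fun do rewrite -JE.
  apply: cvgMl; rewrite -[X in _ --> X]expR0.
  apply: continuous_cvg; first exact: continuous_expR.
  rewrite -[X in _ --> X](mul0r `|t|); apply: cvgMl; rewrite -[X in _ --> X]oppr0.
  by apply: cvgN; exact: cvg_harmonic.
- exact: integrable_abse iJ.
- move=> n t; rewrite JE normrM ger0_norm ?expR_ge0// ler_piMl//.
Qed.

End inversion.

(** * Complex powers and expectations *)

Section complex_exponential.
Context {R : realType}.
Implicit Types (z w : R[i]) (s t x : R).

Lemma cexpD z w : cexp (z + w) = cexp z * cexp w.
Proof.
case: z w => [a b] [c d]; rewrite /cexp /= expRD cosD sinD; simpc.
by congr (_ +i* _); ring.
Qed.

Lemma cexp0 : cexp (0 : R[i]) = 1.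
Proof. by rewrite /cexp /= expR0 cos0 sin0 mulr1 mulr0. Qed.

Lemma cexpV z : (cexp z)^-1 = cexp (- z).
Proof. by apply: mulr1_eq; rewrite -cexpD subrr cexp0. Qed.

Lemma cexpMn z n : cexp (n%:R * z) = cexp z ^+ n.
Proof.
elim: n => [|n IHn]; first by rewrite mul0r cexp0 expr0.
by rewrite exprS -IHn -cexpD -natr1 mulrDl mul1r addrC.
Qed.

Lemma cLog_rposE s t : cLog_rpos (s +i* t) = (ln (s ^+ 2 + t ^+ 2) / 2) +i* atan (t / s).
Proof.
rewrite /cLog_rpos /cmod /=; congr (_ +i* _).
by rewrite -powR12_sqrt ?addr_ge0 ?sqr_ge0// ln_powR mulrC.
Qed.

Lemma cexp_cLog s t : 0 < s -> cexp (cLog_rpos (s +i* t)) = s +i* t.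
Proof.
move=> s0; have st0 := sqrD_gt0 t s0.
have tans : sin (atan (t / s)) = t / s * cos (atan (t / s)).
  have cn0 : cos (atan (t / s)) != 0.
    by rewrite cos_atan invr_eq0 gt_eqF// sqrtr_gt0 ltr_pwDl ?sqr_ge0.
  by have /(congr1 ( *%R^~ (cos (atan (t / s))))) := atanK (t / s); rewrite /tan divfK.
rewrite /cexp /= tans cos_atan /cmod /= lnK ?posrE ?sqrtr_gt0//.
have -> : 1 + (t / s) ^+ 2 = (s ^+ 2 + t ^+ 2) / s ^+ 2.
  by field; rewrite gt_eqF.
rewrite sqrtrM ?ltW// sqrtrV ?sqr_ge0// sqrtr_sqr gtr0_norm//.
have sq0 : Num.sqrt (s ^+ 2 + t ^+ 2) != 0 by rewrite gt_eqF ?sqrtr_gt0.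
by congr (_ +i* _); field; rewrite ?sq0 ?gt_eqF.
Qed.

Lemma cexp_cLog_weight s t (b : R) :
  cexp (- (b%:C * cLog_rpos (s +i* t))) =
  (invmod s b t * cos (- (b * atan (t / s)))) +i* (invmod s b t * sin (- (b * atan (t / s)))).
Proof.
rewrite cLog_rposE /cexp /invmod /=; simpc.
by congr (expR _ * cos _ +i* (expR _ * sin _)); ring.
Qed.

(** Writing z as exp (Log z) puts z^k and z^(-a) on the same branch, so that they merge into
    z^(-(a-k)) and each Taylor term becomes a constant in t times a pure power of z. *)
Lemma e_div_cpow (j : int) s t x (a : R) : 0 < s ->
  e_ j ((s +i* t) * x%:C) / cpow_rpos (s +i* t) a =
  (expR (s * x) * (invmod s a t * cos (t * x - a * atan (t / s))) +i*
   (expR (s * x) * (invmod s a t * sin (t * x - a * atan (t / s))))) -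
  \sum_(0 <= k < absz (j + 1)) (x ^+ k / k`!%:R)%:C *
    ((invmod s (a - k%:R) t * cos (- ((a - k%:R) * atan (t / s)))) +i*
     (invmod s (a - k%:R) t * sin (- ((a - k%:R) * atan (t / s))))).
Proof.
move=> s0; rewrite /e_ /cpow_rpos cexpV mulrBl mulr_suml; congr (_ - _).
  rewrite -cexpD cLog_rposE /cexp /invmod /=; simpc.
  rewrite !mulrA -!expRD.
  by congr (expR _ * cos _ +i* (expR _ * sin _)); ring.
apply: eq_bigr => k _; rewrite -cexp_cLog_weight.
rewrite exprMn -{1}(cexp_cLog t s0) -cexpMn.
transitivity ((x%:C ^+ k / k`!%:R) *
  (cexp (k%:R * cLog_rpos (s +i* t)) * cexp (- (a%:C * cLog_rpos (s +i* t))))).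
  by ring.
rewrite -cexpD; congr (_ * cexp _).
  by rewrite rmorphM rmorphXn /= fmorphV rmorph_nat.
by rewrite rmorphB rmorph_nat; ring.
Qed.

End complex_exponential.

Section laplace_integrand.
Context {R : realType}.
Notation mu := (@lebesgue_measure R).

(** With z = s + it, this is the real part of e^(zx) z^(-b) for [delta = 0] and
    its imaginary part for [delta = - (pi / 2)]. *)
Definition laplace_integrand (s b delta x t : R) : R :=
  expR (s * x) * (invmod s b t * cos (t * x - b * atan (t / s) + delta)).

Lemma laplace_integrand_le (s b delta x t : R) :
  `|laplace_integrand s b delta x t| <= invmod s b t * expR (s * x).
Proof.
rewrite /laplace_integrand normrM (ger0_norm (expR_ge0 _)) mulrC ler_wpM2r ?expR_ge0//.
rewrite normrM (ger0_norm (invmod_ge0 _ _ _)) ler_piMr ?invmod_ge0//.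
by rewrite ler_norml cos_geN1 cos_le1.
Qed.

Lemma laplace_integrand_opp (s b x t : R) :
  laplace_integrand s b 0 x (- t) = laplace_integrand s b 0 x t.
Proof.
rewrite /laplace_integrand /invmod sqrrN !addr0 (mulNr t s^-1) atanN -[in RHS]cosN.
by congr (_ * (_ * cos _)); ring.
Qed.

Lemma laplace_integrand_opp_sin (s b x t : R) :
  laplace_integrand s b (- (pi / 2)) x (- t) = - laplace_integrand s b (- (pi / 2)) x t.
Proof.
rewrite /laplace_integrand /invmod sqrrN !cosBpihalf (mulNr t s^-1) atanN.
rewrite (_ : - t * x - b * - atan (t / s) = - (t * x - b * atan (t / s))); last by ring.
by rewrite sinN; ring.
Qed.

Lemma integrable_laplace_integrand (s b delta x : R) : 0 < s -> 1 < b ->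
  mu.-integrable setT (EFin \o laplace_integrand s b delta x).
Proof.
move=> s0 b1.
apply: (le_integrable _ _ _ (integrableZl measurableT (expR (s * x)) (integrable_invmod s0 b1))) => //.
  apply/measurable_EFinP; apply: measurable_funM => //.
  apply: measurable_funM; first exact: measurable_invmod.
  apply: measurable_cos_comp; apply: measurable_funD => //.
  apply: measurable_funB; first exact: mulrr_measurable.
  by apply: measurable_funM => //; exact: measurable_atan_div.
move=> t _ /=; rewrite lee_fin (le_trans (laplace_integrand_le _ _ _ _ _))// mulrC.
exact: ler_norm.
Qed.

Lemma Gamma_neq0 (p : R) : 0 < p -> Gamma (p + 1) != 0.
Proof.
(* Otherwise the inversion formula at x = 1 would read 0 = 2 pi e^(-1). *)
move=> p0; apply/eqP => G0.
have := gamma_inversion 1 p0 ltr01; rewrite G0 mul0r gamma_kernel_gt0E//.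
move/esym/eqP; rewrite gt_eqF//.
by rewrite !mulr_gt0 ?pi_gt0 ?powR_gt0 ?expR_gt0.
Qed.

Lemma Rintegral_laplace_integrand (p s x : R) : 0 < p -> 0 < s ->
  \int[mu]_t laplace_integrand s (p + 1) 0 x t =
  2 * pi / Gamma (p + 1) * Num.max x 0 `^ p.
Proof.
move=> p0 s0; have G0 := Gamma_neq0 p0.
have p11 : 1 < p + 1 by rewrite ltrDr.
apply: (mulfI G0); rewrite mulrA mulrCA divff// mulr1.
transitivity (expR (s * x) * (2 * pi * gamma_kernel p s x)); last first.
  transitivity (2 * pi * Num.max x 0 `^ p * (expR (s * x) * expR (- s * x))).
    by rewrite /gamma_kernel; ring.
  by rewrite -expRD mulNr subrr expR0 mulr1.
rewrite -gamma_inversion// mulrCA; congr (_ * _).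
rewrite -RintegralZl//; last exact: integrable_invmod_cos.
by apply: eq_Rintegral => t _; rewrite /laplace_integrand addr0.
Qed.

Lemma Rintegral_laplace_integrand0 (b s : R) : 1 < b -> 0 < s ->
  \int[mu]_t laplace_integrand s b 0 0 t = 0.
Proof.
move=> b1 s0; rewrite -(subrK 1 b) Rintegral_laplace_integrand ?subr_gt0//.
by rewrite maxxx powR0 ?mulr0// gt_eqF// subr_gt0.
Qed.

Lemma Re_e_div_cpow (j : int) (s t x a : R) : 0 < s ->
  complex.Re (e_ j ((s +i* t) * x%:C) / cpow_rpos (s +i* t) a) =
  laplace_integrand s a 0 x t -
  \sum_(k < absz (j + 1)) x ^+ k / k`!%:R * laplace_integrand s (a - k%:R) 0 0 t.
Proof.
move=> s0; rewrite e_div_cpow// raddfB big_mkord /=.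
rewrite (big_morph (@complex.Re R) (id1 := 0) (op1 := +%R)) //; last by case=> ? ? [].
rewrite /laplace_integrand !addr0; congr (_ - _); apply: eq_bigr => k _.
by rewrite mulr0 expR0 mul1r mulr0 sub0r addr0; simpc.
Qed.

Lemma Im_e_div_cpow (j : int) (s t x a : R) : 0 < s ->
  complex.Im (e_ j ((s +i* t) * x%:C) / cpow_rpos (s +i* t) a) =
  laplace_integrand s a (- (pi / 2)) x t -
  \sum_(k < absz (j + 1)) x ^+ k / k`!%:R * laplace_integrand s (a - k%:R) (- (pi / 2)) 0 t.
Proof.
move=> s0; rewrite e_div_cpow// raddfB big_mkord /=.
rewrite (big_morph (@complex.Im R) (id1 := 0) (op1 := +%R)) //; last by case=> ? ? [].
rewrite /laplace_integrand !cosBpihalf; congr (_ - _); apply: eq_bigr => k _.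
by rewrite cosBpihalf mulr0 expR0 mul1r mulr0 sub0r; simpc.
Qed.

End laplace_integrand.

(** * Exchange of expectation and integration in t *)

Section expectation.
Context {R : realType} d (T : measurableType d) (P : probability T R).
Notation mu := (@lebesgue_measure R).
Variables (X : T -> R) (s : R) (n : nat).
Hypotheses (mX : measurable_fun setT X) (s0 : 0 < s).
Hypothesis iexp : P.-integrable setT (EFin \o (fun w => expR (s * X w))).
Hypothesis ipow : forall k, (k < n)%N -> P.-integrable setT (EFin \o (fun w => X w ^+ k)).

(** Likewise, the real or imaginary part of e_(n-1)(zX) z^(-b). *)
Definition truncated_integrand (b delta t : R) (w : T) : R :=
  laplace_integrand s b delta (X w) t -
  \sum_(k < n) X w ^+ k / k`!%:R * laplace_integrand s (b - k%:R) delta 0 t.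

Let measurable_laplace b delta :
  measurable_fun setT (fun tw : measurableTypeR R * T =>
    laplace_integrand s b delta (X tw.2) tw.1).
Proof.
have mX2 : measurable_fun setT (fun tw : measurableTypeR R * T => X tw.2).
  exact: (measurableT_comp mX).
have m1 : measurable_fun setT (fun tw : measurableTypeR R * T => tw.1).
  exact: measurable_fst.
apply: measurable_funM.
  by apply: measurableT_comp => //; apply: measurable_funM.
apply: measurable_funM; first exact: (measurableT_comp (measurable_invmod b s0)).
apply: measurable_cos_comp; apply: measurable_funD => //.
apply: measurable_funB; first exact: measurable_funM.
by apply: measurable_funM => //; exact: (measurableT_comp (measurable_atan_div s)).
Qed.

Lemma integrable_laplace_expectation b delta t :
  P.-integrable setT (EFin \o (fun w => laplace_integrand s b delta (X w) t)).
Proof.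
apply: (le_integrable measurableT _ _ (integrableZl measurableT (invmod s b t) iexp)).
  apply/measurable_EFinP.
  exact: (measurableT_comp (measurable_laplace b delta) (measurable_pair1 t)).
move=> w _ /=; rewrite lee_fin (le_trans (laplace_integrand_le _ _ _ _ _))//.
exact: ler_norm.
Qed.

Let integrable_term (k : 'I_n) c :
  P.-integrable setT (EFin \o (fun w => X w ^+ k / k`!%:R * c)).
Proof.
have := integrableZl measurableT (c / k`!%:R) (ipow (ltn_ord k)).
by apply: eq_integrable => // w _ /=; rewrite -EFinM; congr EFin; ring.
Qed.

Lemma integrable_truncated_integrand b delta t :
  P.-integrable setT (EFin \o truncated_integrand b delta t).
Proof.
have [isum _] := integrable_Rintegral_sum (index_enum 'I_n)
  (fun (k : 'I_n) (_ : true) => integrable_term k (laplace_integrand s (b - k%:R) delta 0 t)).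
exact: (integrableB measurableT (integrable_laplace_expectation b delta t) isum).
Qed.

Lemma Rintegral_truncated_integrand b delta t :
  \int[P]_w truncated_integrand b delta t w =
  \int[P]_w laplace_integrand s b delta (X w) t -
  \sum_(k < n) (\int[P]_w (X w ^+ k)) / k`!%:R * laplace_integrand s (b - k%:R) delta 0 t.
Proof.
have [isum esum] := integrable_Rintegral_sum (index_enum 'I_n)
  (fun (k : 'I_n) (_ : true) => integrable_term k (laplace_integrand s (b - k%:R) delta 0 t)).
rewrite RintegralB//; last exact: integrable_laplace_expectation.
rewrite esum; congr (_ - _); apply: eq_bigr => k _.
transitivity (\int[P]_w ((laplace_integrand s (b - k%:R) delta 0 t / k`!%:R) * X w ^+ k)).
  by apply: eq_Rintegral => w _; ring.
by rewrite RintegralZl//; [ring|exact: ipow].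
Qed.

Section time_integral.
Variable p : R.
Hypotheses (p0 : 0 < p) (np : forall k, (k < n)%N -> k%:R < p).

Let p11 : 1 < p + 1. Proof. by rewrite ltrDr. Qed.

Let pk (k : 'I_n) : 1 < p + 1 - k%:R.
Proof. by have := np (ltn_ord k); lra. Qed.

Let integrable_term_t delta (k : 'I_n) c :
  mu.-integrable setT (EFin \o (fun t => c * laplace_integrand s (p + 1 - k%:R) delta 0 t)).
Proof. exact: (integrableZl measurableT c (integrable_laplace_integrand delta 0 s0 (pk k))). Qed.

Let invmod_int := integrable_invmod s0 p11.

Let bound (delta t : R) (w : T) :
  `|(fun tw : measurableTypeR R * T => laplace_integrand s (p + 1) delta (X tw.2) tw.1) (t, w)|
  <= invmod s (p + 1) t * expR (s * X w).
Proof. exact: laplace_integrand_le. Qed.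

(** The Taylor terms are split off under the expectation, where each is a moment times a function of
    t alone; only the exponential term needs the product majorant |z|^(-a) e^(sX). *)
Lemma integrable_truncated_transform delta :
  mu.-integrable setT (EFin \o (fun t => \int[P]_w truncated_integrand (p + 1) delta t w)).
Proof.
have i1 := integrable_Rintegral1 (measurable_laplace (p + 1) delta) invmod_int iexp (bound delta).
have [i2 _] := integrable_Rintegral_sum (index_enum 'I_n)
  (fun (k : 'I_n) (_ : true) => integrable_term_t delta k ((\int[P]_w (X w ^+ k)) / k`!%:R)).
apply: eq_integrable (integrableB measurableT i1 i2) => // t _.
by rewrite /= Rintegral_truncated_integrand.
Qed.

Lemma Rintegral_truncated_transform :
  \int[mu]_t \int[P]_w truncated_integrand (p + 1) 0 t w =
  \int[P]_w (2 * pi / Gamma (p + 1) * Num.max (X w) 0 `^ p).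
Proof.
have i1 := integrable_Rintegral1 (measurable_laplace (p + 1) 0) invmod_int iexp (bound 0).
have [i2 e2] := integrable_Rintegral_sum (index_enum 'I_n)
  (fun (k : 'I_n) (_ : true) => integrable_term_t 0 k ((\int[P]_w (X w ^+ k)) / k`!%:R)).
under eq_Rintegral do rewrite Rintegral_truncated_integrand.
rewrite RintegralB// e2 big1 ?subr0; last first.
  move=> k _; rewrite RintegralZl//; last exact: integrable_laplace_integrand.
  by rewrite Rintegral_laplace_integrand0 ?mulr0.
rewrite (dominated_Fubini (measurable_laplace (p + 1) 0) invmod_int iexp (bound 0)).
by apply: eq_Rintegral => w _; rewrite /= Rintegral_laplace_integrand.
Qed.

(** Boundedness of the gamma kernel reads x_+^p <= K e^(sx), so the exponential moment controls this
    one. *)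
Lemma integrable_powR_pos : P.-integrable setT (EFin \o (fun w => Num.max (X w) 0 `^ p)).
Proof.
have [K K0 gK] := gamma_kernel_bounded p0 s0.
apply: (le_integrable measurableT _ _ (integrableZl measurableT K iexp)).
  apply/measurable_EFinP; apply: (measurableT_comp (measurable_powR p)).
  exact: measurable_maxr.
move=> w _ /=; rewrite lee_fin ger0_norm ?powR_ge0//.
rewrite (le_trans _ (ler_norm _))//.
have := gK (X w); rewrite /gamma_kernel mulNr -(ler_pM2r (expR_gt0 (s * X w))).
by rewrite -mulrA -expRD addNr expR0 mulr1.
Qed.

End time_integral.
End expectation.

Section complex_transform.
Context {R : realType} d (T : measurableType d) (P : probability T R).
Variables (X : T -> R) (s : R) (j : int).
Hypotheses (mX : measurable_fun setT X) (s0 : 0 < s).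
Hypothesis iexp : P.-integrable setT (EFin \o (fun w => expR (s * X w))).
Hypothesis ipow : forall k, (k < absz (j + 1)%R)%N ->
  P.-integrable setT (EFin \o (fun w => X w ^+ k)).

Let EZ (t : R) (w : T) : R[i] := e_ j ((s +i* t) * (X w)%:C).

Lemma cpow_rpos0 (z : R[i]) : cpow_rpos z 0 = 1.
Proof. by rewrite /cpow_rpos rmorph0 mul0r cexp0. Qed.

(* [cpow_rpos z 0 = 1], so [e_] itself is the case [a = 0] of [Re_e_div_cpow]. *)
Let ReEZ t : (fun w => complex.Re (EZ t w)) =
  truncated_integrand X s (absz (j + 1)) 0 0 t.
Proof. by apply/funext => w; rewrite -[EZ t w]divr1 -(cpow_rpos0 (s +i* t)) Re_e_div_cpow. Qed.

Let ImEZ t : (fun w => complex.Im (EZ t w)) =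
  truncated_integrand X s (absz (j + 1)) 0 (- (pi / 2)) t.
Proof. by apply/funext => w; rewrite -[EZ t w]divr1 -(cpow_rpos0 (s +i* t)) Im_e_div_cpow. Qed.

Lemma integrable_Re_e t : P.-integrable setT (EFin \o (fun w => complex.Re (EZ t w))).
Proof. by rewrite ReEZ; exact: integrable_truncated_integrand. Qed.

Lemma integrable_Im_e t : P.-integrable setT (EFin \o (fun w => complex.Im (EZ t w))).
Proof. by rewrite ImEZ; exact: integrable_truncated_integrand. Qed.

(** Dividing by the power is multiplication by a constant u + iv, a real linear map of the pair of
    real and imaginary parts, and therefore commutes with the expectation. *)
Lemma expectation_e_div_cpow (a t : R) :
  ((\int[P]_w complex.Re (EZ t w)) +i* (\int[P]_w complex.Im (EZ t w)))
    / cpow_rpos (s +i* t) a =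
  (\int[P]_w truncated_integrand X s (absz (j + 1)) a 0 t w) +i*
  (\int[P]_w truncated_integrand X s (absz (j + 1)) a (- (pi / 2)) t w).
Proof.
have mulE (A B u v : R) : (A +i* B) * (u +i* v) = (u * A - v * B) +i* (v * A + u * B).
  by simpc; congr (_ +i* _); ring.
have iR := integrable_Re_e t; have iI := integrable_Im_e t.
have iZ k f : P.-integrable setT (EFin \o f) -> P.-integrable setT (EFin \o (fun w : T => k * f w)).
  by move=> fi; exact: (integrableZl measurableT k fi).
case E : (cpow_rpos (s +i* t) a)^-1 => [u v].
have EZw w : EZ t w / cpow_rpos (s +i* t) a =
    (u * complex.Re (EZ t w) - v * complex.Im (EZ t w)) +i*
    (v * complex.Re (EZ t w) + u * complex.Im (EZ t w)).
  by rewrite E -mulE; case: (EZ t w).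
rewrite mulE -!RintegralZl//.
rewrite -RintegralB//; [|exact: iZ|exact: iZ].
rewrite -RintegralD//; [|exact: iZ|exact: iZ].
congr (_ +i* _); apply: eq_Rintegral => w _.
  by rewrite /truncated_integrand -Re_e_div_cpow// EZw.
by rewrite /truncated_integrand -Im_e_div_cpow// EZw.
Qed.

End complex_transform.

(** For k <= m one has |x|^k <= 1 + |x|^m, and constants are integrable for a probability. *)
Lemma integrable_powS {R : realType} d (T : measurableType d) (P : probability T R)
    (X : T -> R) (m k : nat) : measurable_fun setT X -> (k <= m)%N ->
  P.-integrable setT (EFin \o (fun w => `|X w| ^+ m)) ->
  P.-integrable setT (EFin \o (fun w => X w ^+ k)).
Proof.
move=> mX km im.
have i1 : P.-integrable setT (EFin \o (fun _ : T => 1 : R)).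
  exact: finite_measure_integrable_cst.
apply: (le_integrable measurableT _ _ (integrableD measurableT i1 im)).
  by apply/measurable_EFinP; exact: measurable_funX.
move=> w _ /=; rewrite lee_fin normrX [leRHS]ger0_norm; last by rewrite addr_ge0// exprn_ge0.
have [X1|/ltW X1] := leP `|X w| 1.
  by rewrite (le_trans (exprn_ile1 _ _ _))// lerDl exprn_ge0.
by rewrite (le_trans (ler_weXn2l X1 km))// lerDr.
Qed.

End Laplace_inversion.

(** * Moments of the positive part *)

Theorem theorem2p1 (R : realType) (d : measure_display) (T : measurableType d)
  (P : probability T R) (X : {RV P >-> R}) (s1 s2 p : R) :
  s1 <= 0 -> 0 <= s2 ->
  (forall s : R, s1 <= s <= s2 ->
     (\int[P]_x (expR (s * X x))%:E < +oo)%E) ->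
  0 < p ->
  forall (s : R) (j : int),
    0 < s <= s2 ->
    -1 <= j <= Num.ceil (p - 1) ->
    (\int[P]_x (`|X x| ^ Num.max 0 j)%:E < +oo)%E ->
    let EZ (t : R) (x : T) : R[i] := e_ j ((s +i* t) * (X x)%:C) in
    let F (t : R) : R[i] :=
      ((\int[P]_x complex.Re (EZ t x)) +i* (\int[P]_x complex.Im (EZ t x)))
        / cpow_rpos (s +i* t) (p + 1) in
    [/\ (forall t : R,
           P.-integrable setT (fun x => (complex.Re (EZ t x))%:E) /\
           P.-integrable setT (fun x => (complex.Im (EZ t x))%:E)),
        (@lebesgue_measure R).-integrable setT (fun t => (complex.Re (F t))%:E),
        (@lebesgue_measure R).-integrable setT (fun t => (complex.Im (F t))%:E),
        (@lebesgue_measure R).-integrable `]0%R, +oo[%classic (fun t => (complex.Re (F t))%:E)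
      & [/\ \int[@lebesgue_measure R]_t complex.Im (F t) = 0,
            (\int[P]_x (powR (Num.max (X x) 0) p)%:E =
               (Gamma (p + 1) / (2 * pi) * \int[@lebesgue_measure R]_t complex.Re (F t))%:E)%E
          & (\int[P]_x (powR (Num.max (X x) 0) p)%:E =
               (Gamma (p + 1) / pi *
                  \int[@lebesgue_measure R]_(t in `]0%R, +oo[%classic) complex.Re (F t))%:E)%E]].
Proof.
move=> s1_le0 s2_ge0 hexp p0 s j /andP[s0 ss2] /andP[j_ge jp] hpow EZ F.
have mX : measurable_fun setT X by [].
have iexp : P.-integrable setT (EFin \o (fun w => expR (s * X w))).
  apply/integrableP; split.
    by apply/measurable_EFinP; apply: measurableT_comp => //; exact: measurable_funM.
  under eq_integral do rewrite /= ger0_norm ?expR_ge0//.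
  by apply: hexp; rewrite ss2 (le_trans s1_le0)// ltW.
(* For j = -1 there is no Taylor term, so the conditions on moments and exponents below are
   vacuous. *)
have j_nat : j = -1 \/ exists m : nat, j = m.
  case: j j_ge {hpow jp EZ F} => [m _|m]; first by right; exists m.
  by rewrite NegzE => j_ge; left; lia.
have ipow k : (k < absz (j + 1)%R)%N -> P.-integrable setT (EFin \o (fun w => X w ^+ k)).
  case: j_nat => [->|[m jm]]; first by rewrite addNr.
  move: hpow; rewrite jm => hm km; apply: (@integrable_powS _ _ _ _ _ m) => //.
    by move: km; rewrite -PoszD absz_nat addn1.
  apply/integrableP; split.
    apply/measurable_EFinP; apply: measurable_funX.
    exact: measurableT_comp.
  apply: le_lt_trans hm; rewrite le_eqVlt; apply/orP; left; apply/eqP.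
  apply: eq_integral => w _ /=; rewrite ger0_norm ?exprn_ge0//.
  by rewrite max_r.
have np k : (k < absz (j + 1)%R)%N -> k%:R < p.
  case: j_nat => [->|[m jm]]; first by rewrite addNr.
  move: jp; rewrite jm -PoszD absz_nat addn1 ltnS => mp km.
  (* An integer strictly below the ceiling of p - 1 is strictly below p - 1; for the integer k - 1
     this yields the strict bound k < p. *)
  have : (k%:Z - 1)%:~R < p - 1.
    by rewrite -ceil_gt_int (lt_le_trans _ mp)// ltrBlDr ltz_nat addn1 ltnS.
  by rewrite intrB ltrD2r.
have ReF t : complex.Re (F t) = \int[P]_w truncated_integrand X s (absz (j + 1)) (p + 1) 0 t w.
  by rewrite /F expectation_e_div_cpow.
have ImF t : complex.Im (F t) =
    \int[P]_w truncated_integrand X s (absz (j + 1)) (p + 1) (- (pi / 2)) t w.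
  by rewrite /F expectation_e_div_cpow.
have iRe : (@lebesgue_measure R).-integrable setT (fun t => (complex.Re (F t))%:E).
  under eq_fun do rewrite ReF.
  exact: integrable_truncated_transform.
have iIm : (@lebesgue_measure R).-integrable setT (fun t => (complex.Im (F t))%:E).
  under eq_fun do rewrite ImF.
  exact: integrable_truncated_transform.
have intRe : \int[@lebesgue_measure R]_t complex.Re (F t) =
    2 * pi / Gamma (p + 1) * \int[P]_w (Num.max (X w) 0 `^ p).
  under eq_Rintegral do rewrite ReF.
  rewrite Rintegral_truncated_transform// RintegralZl//.
  exact: (integrable_powR_pos mX s0 iexp p0).
(* As X is real, [F (- t)] is the conjugate of [F t]: the real part folds onto the half-line, and
   the imaginary part integrates to 0. *)
have evenRe t : complex.Re (F (- t)) = complex.Re (F t).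
  rewrite !ReF; apply: eq_Rintegral => w _; rewrite /truncated_integrand.
  rewrite laplace_integrand_opp; congr (_ - _).
  by apply: eq_bigr => k _; rewrite laplace_integrand_opp.
have oddIm t : complex.Im (F (- t)) = - complex.Im (F t).
  rewrite !ImF -[RHS]mulN1r -RintegralZl//; last exact: integrable_truncated_integrand.
  apply: eq_Rintegral => w _; rewrite /truncated_integrand mulN1r opprB addrC.
  rewrite laplace_integrand_opp_sin; congr (_ - _); rewrite -sumrN.
  by apply: eq_bigr => k _; rewrite laplace_integrand_opp_sin mulrN opprK.
have G0 := Gamma_neq0 p0.
have pi0 : pi != 0 :> R by rewrite gt_eqF ?pi_gt0.
(* The real-valued integral would be 0 by default for an infinite expectation, so this
   identification rests on the finiteness of the moment. *)
have EX : (\int[P]_x (Num.max (X x) 0 `^ p)%:E = (\int[P]_x (Num.max (X x) 0 `^ p))%:E)%E.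
  rewrite /Rintegral fineK//; apply: integrable_fin_num => //.
  exact: (integrable_powR_pos mX s0 iexp p0).
have cancel (G q e : R) : G != 0 -> q != 0 -> G / (2 * q) * (2 * q / G * e) = e.
  by move=> Gn0 qn0; field; rewrite Gn0.
have half (G q e : R) : q != 0 -> G / (2 * q) * (2 * e) = G / q * e.
  by move=> qn0; field.
split => //.
- by move=> t; split; [exact: integrable_Re_e|exact: integrable_Im_e].
- exact: integrableS iRe.
- split.
  + exact: Rintegral_odd.
  + by rewrite EX intRe cancel.
  + rewrite EX -(cancel _ pi (\int[P]_w _) G0 pi0) -intRe (Rintegral_even iRe evenRe).
    by rewrite half.
Qed.
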